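(* $$\lim_{k\to\infty}\sigma(k\text{-Set Partitioning}/n)\le\sigma(\text{Subset Sum}/m),$$ where for Subset Sum the parameter $m$ is the number of bits of the target integer.
   Context: For a problem $\Pi$ with input size $N$ and a numerical parameter $p$ of the instance, $\sigma(\Pi/p)$ is the infimum of all $\epsilon>0$ such that $\Pi$ has a randomized algorithm with error probability at most $1/3$ running in time $2^{\epsilon p}\mathrm{poly}(N)$. $k$-Set Partitioning: given an integer $t$ and $\mathcal F\subseteq 2^U$, $|U|=n$, every set of size at most $k$, decide whether there is $\mathcal C\subseteq\mathcal F$ with $|\mathcal C|=t$ whose members are pairwise disjoint with union $U$. Subset Sum: given positive integers $a_1,\dots,a_n$ and a target integer $t$ written with $m$ bits, decide whether there is $X\subseteq\{1,\dots,n\}$ with $\sum_{i\in X}a_i=t$. *)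

(* Defs.v *)
From mathcomp Require Import all_boot all_order all_algebra.
Set Implicit Arguments.
Unset Strict Implicit.
Unset Printing Implicit Defensive.

(* Length of the binary expansion of n, with one digit for n = 0. *)
Definition bitlen (n : nat) : nat := (trunc_log 2 n).+1.

(* Probabilistic random-access machine with logarithmic costs (Cook-Reckhow):  *)
(* finitely many named registers, an addressable memory, structured control.   *)
(* The arithmetic is limited to addition and truncated subtraction.            *)
Inductive cmd : Type :=
| Skip
| Const (x c : nat)
| Add (x y z : nat)
| Sub (x y z : nat)
| Read (x y : nat)        (* x := mem[y] *)
| Write (x y : nat)       (* mem[x] := y *)
| Flip (x : nat)          (* x := fair random bit *)
| Seq (c1 c2 : cmd)
| If (x : nat) (c1 c2 : cmd)
| While (x : nat) (c : cmd).

Record state : Type := State { regs : nat -> nat; mem : nat -> nat }.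

Definition upd (f : nat -> nat) (x v : nat) : nat -> nat :=
  fun y => if y == x then v else f y.

Definition setr (s : state) (x v : nat) : state := State (upd (regs s) x v) (mem s).
Definition setm (s : state) (a v : nat) : state := State (regs s) (upd (mem s) a v).

(* exec c s w s' w' t : started in s with random bits w, the command c halts   *)
(* in s' at cost t, leaving w' unread. It is stuck if it runs out of bits.     *)
Inductive exec : cmd -> state -> seq bool -> state -> seq bool -> nat -> Prop :=
| exec_skip s w : exec Skip s w s w 1
| exec_const x c s w : exec (Const x c) s w (setr s x c) w (bitlen c)
| exec_add x y z s w :
    exec (Add x y z) s w (setr s x (regs s y + regs s z)) w
         (bitlen (regs s y) + bitlen (regs s z))
| exec_sub x y z s w :
    exec (Sub x y z) s w (setr s x (regs s y - regs s z)) w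
         (bitlen (regs s y) + bitlen (regs s z))
| exec_read x y s w :
    exec (Read x y) s w (setr s x (mem s (regs s y))) w
         (bitlen (regs s y) + bitlen (mem s (regs s y)))
| exec_write x y s w :
    exec (Write x y) s w (setm s (regs s x) (regs s y)) w
         (bitlen (regs s x) + bitlen (regs s y))
| exec_flip x s b w : exec (Flip x) s (b :: w) (setr s x b) w 1
| exec_seq c1 c2 s w s1 w1 t1 s2 w2 t2 :
    exec c1 s w s1 w1 t1 -> exec c2 s1 w1 s2 w2 t2 ->
    exec (Seq c1 c2) s w s2 w2 (t1 + t2)
| exec_if x c1 c2 s w s' w' t :
    exec (if regs s x != 0 then c1 else c2) s w s' w' t ->
    exec (If x c1 c2) s w s' w' (bitlen (regs s x) + t)
| exec_while_stop x c s w :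
    regs s x = 0 -> exec (While x c) s w s w (bitlen (regs s x))
| exec_while_step x c s w s1 w1 t1 s2 w2 t2 :
    regs s x <> 0 -> exec c s w s1 w1 t1 ->
    exec (While x c) s1 w1 s2 w2 t2 ->
    exec (While x c) s w s2 w2 (bitlen (regs s x) + t1 + t2).

(* The input occupies memory cells 0, 1, 2, ...; all the rest is zero. *)
Definition init (input : seq nat) : state := State (fun=> 0) (nth 0 input).

Definition accepting (s : state) : bool := regs s 0 != 0.

(* The instances are exactly the legal inputs: an algorithm need not behave on *)
(* other strings.                                                              *)
Record problem : Type := Problem {
  instance : Type;
  encode : instance -> seq nat;
  answer : instance -> bool
}.

Definition input_size (Pi : problem) (x : instance Pi) : nat :=
  \sum_(v <- encode x) bitlen v.

(* The universe is U = 'I_n; the family may be listed in any order. *)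
Record set_partitioning_instance (k : nat) : Type := SetPartitioningInstance {
  sp_n : nat;
  sp_target : nat;
  sp_family : seq {set 'I_sp_n};
  sp_family_uniq : uniq sp_family;
  sp_family_size : all (fun A : {set 'I_sp_n} => #|A| <= k) sp_family
}.

(* n, t, the number of sets, then the characteristic vector of each set. *)
Definition sp_encode (k : nat) (x : set_partitioning_instance k) : seq nat :=
  [:: sp_n x, sp_target x, size (sp_family x) &
      flatten [seq [seq nat_of_bool (i \in A) | i <- enum 'I_(sp_n x)]
              | A : {set 'I_(sp_n x)} <- sp_family x]].

(* [partition C setT] would wrongly forbid the empty set as a member of C. *)
Definition sp_answer (k : nat) (x : set_partitioning_instance k) : bool :=
  [exists C : {set {set 'I_(sp_n x)}},
    [&& C \subset sp_family x, #|C| == sp_target x,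
        trivIset C & cover C == [set: 'I_(sp_n x)]]].

Definition set_partitioning (k : nat) : problem :=
  Problem (@sp_encode k) (@sp_answer k).

Definition universe_size (k : nat) (x : instance (set_partitioning k)) : nat :=
  sp_n x.

Record subset_sum_instance : Type := SubsetSumInstance {
  ss_items : seq nat;
  ss_target : nat;
  ss_items_pos : all (fun a => 0 < a) ss_items
}.

Definition ss_encode (x : subset_sum_instance) : seq nat :=
  [:: size (ss_items x), ss_target x & ss_items x].

Definition ss_answer (x : subset_sum_instance) : bool :=
  [exists X : {set 'I_(size (ss_items x))},
    \sum_(i in X) nth 0 (ss_items x) i == ss_target x].

Definition subset_sum : problem := Problem ss_encode ss_answer.

Definition target_bits (x : instance subset_sum) : nat := bitlen (ss_target x).

(* The fraction of the random strings of length l on which out is wrong. *)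
Definition error_probability (R : fieldType) (l : nat)
    (out : l.-tuple bool -> bool) (ans : bool) : R :=
  (#|[set w : l.-tuple bool | out w != ans]|%:R / #|{: l.-tuple bool}|%:R)%R.

From mathcomp Require Import all_classical all_reals all_analysis.
Import Order.TTheory GRing.Theory Num.Theory.
Import numFieldNormedType.Exports.
Local Open Scope classical_set_scope.
Local Open Scope ring_scope.

(* Here l is any number of random bits sufficient for all runs on the input,   *)
(* and out is the outcome as a function of these bits.                         *)
Definition decides_within (R : realType) (c : cmd) (input : seq nat)
    (ans : bool) (B : R) : Prop :=
  exists (l : nat) (out : l.-tuple bool -> bool),
    (forall w : l.-tuple bool, exists s w' t,
       [/\ exec c (init input) w s w' t, accepting s = out w & t%:R <= B])
    /\ error_probability R out ans <= 1 / 3.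

(* Solvability in time 2 ^ (eps * p) * poly(N). *)
Definition solvable_with_exponent (R : realType) (Pi : problem)
    (p : instance Pi -> nat) (eps : R) : Prop :=
  exists (c : cmd) (a d : nat), forall x : instance Pi,
    decides_within c (encode x) (answer x)
      (2 `^ (eps * (p x)%:R) * (a * (input_size x).+1 ^ d)%:R).

(* Extended-real infimum: +oo if there is no algorithm for any eps. *)
Definition sigma (R : realType) (Pi : problem) (p : instance Pi -> nat) : \bar R :=
  ereal_inf [set eps%:E | eps in
    [set eps : R | 0 < eps /\ solvable_with_exponent p eps]].
Arguments sigma : clear implicits.

(* Main.v *)
(* A family C of sets partitions [n] exactly when the characteristic vectors   *)
(* of its members, read as binary numbers, add up to 2 ^ n - 1 without a       *)
(* carry, that is, when moreover their cardinalities add up to n: n powers of  *)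
(* two cannot have a sum with n binary ones unless they are distinct. Putting  *)
(* the cardinality and a counter for the sets into O(log n) further bits turns *)
(* Set Partitioning into Subset Sum with n + O(log n) target bits. A machine   *)
(* performs this in polynomial time, reading the input and writing the output  *)
(* in place, so sigma for k-Set Partitioning is at most sigma for Subset Sum   *)
(* for every k; it is also nondecreasing in k, hence convergent.               *)
Require Import Defs.
From mathcomp Require Import all_boot all_order all_algebra zify.
From mathcomp Require Import boolp.
Set Implicit Arguments.
Unset Strict Implicit.
Unset Printing Implicit Defensive.

(** A subfamily is described by three numbers: its size, the sum of its cardinalities, and the sum
    of its characteristic vectors in binary. They are the digits of a single sum of items, in bases
    that prevent overflow ([item_sum_digits]). By [sum_powers_no_carry] the digits [t], [n] and
    [2 ^ n - 1] single out the partitions ([item_sumP]), so the answers agree ([ss_answer_reduce]).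

    The program [reduction] ends exactly in the initial state of the Subset Sum instance
    ([runs_reduction]), so any Subset Sum program can be appended to it. Its cost is polynomial and
    [2 ^ m] is at most a polynomial times [2 ^ n] ([reduction_cost]). Raising the latter to the
    power [eps] keeps the extra factor polynomial ([reduction_time_le]), so every exponent achieved
    for Subset Sum is achieved for each [k]. The limit exists because the exponents are monotone in
    [k]. *)

(** * Partitions as solutions of one integer equation *)

Lemma sum_expn2 (n : nat) : \sum_(i < n) 2 ^ i = 2 ^ n - 1.
Proof. by rewrite subn1 predn_exp mul1n. Qed.

(* 2 ^ n - 1 has n ones in binary, so n powers of two with this sum cannot     *)
(* produce a carry; the induction pushes the carry r into the next exponent.   *)
Lemma sum_powers_no_carry (n : nat) (c : nat -> nat) :
  \sum_(i < n) c i * 2 ^ i = 2 ^ n - 1 -> \sum_(i < n) c i <= n ->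
  forall i, i < n -> c i = 1.
Proof.
elim: n c => [//|n IH] c; rewrite !big_ord_recl muln1.
pose q := \sum_(i < n) c i.+1 * 2 ^ i.
have -> : \sum_(i < n) c (bump 0 i) * 2 ^ bump 0 i = 2 * q.
  by rewrite big_distrr; apply: eq_bigr => i _; rewrite /bump add1n expnS mulnCA.
rewrite expnS => /= hq hs.
have pos : 0 < 2 ^ n by rewrite expn_gt0.
pose r := (c 0)./2.
(* The total is odd and every other term is even. *)
have c0 : c 0 = r.*2.+1.
  have := odd_double_half (c 0); rewrite -/r; move: hq; case: (odd _) => /= ;lia.
case: n => [|n] in IH q hq hs pos *.
  by case=> // _; move: hs; rewrite big_ord0 /=; lia.
pose c' i := c i.+1 + (i == 0) * r.
have sc' (w : nat -> nat) : w 0 = 1 ->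
    \sum_(i < n.+1) c' i * w i = \sum_(i < n.+1) c i.+1 * w i + r.
  move=> w0; rewrite !big_ord_recl /= w0 /c' /= mul1n !muln1 addnAC; congr (_ + _ + _).
  by apply: eq_bigr => i _; rewrite addn0.
have hsum : \sum_(i < n.+1) c' i = \sum_(i < n.+1) c i.+1 + r.
  have := sc' (fun=> 1) erefl; under eq_bigr do rewrite muln1.
  by move=> ->; congr (_ + _); apply: eq_bigr => i _; rewrite muln1.
have hs' : r.*2.+1 + \sum_(i < n.+1) c i.+1 <= n.+2 by rewrite -c0.
have hc' : forall i, i < n.+1 -> c' i = 1.
  apply: IH; last by rewrite hsum; lia.
  by rewrite sc' // -/q; lia.
(* The shifted counts add up to exactly [n.+1], while a carry [r] would use up [r] more units than
   the bound on the sum of [c] allows. *)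
have r0 : r = 0.
  move: hsum; rewrite (eq_bigr (fun=> 1)) => [|i _]; last by rewrite hc'.
  rewrite sum1_card card_ord; lia.
case=> [_|i lt_i]; first by rewrite c0 r0.
by have := hc' i lt_i; rewrite /c' r0 muln0 addn0.
Qed.

(** Nonempty disjoint members each take at least one point of [T]; the additional one is the empty
    set. *)
Lemma card_trivIset (T : finType) (C : {set {set T}}) :
  trivIset C -> #|C| <= #|T|.+1.
Proof.
move=> /eqP triv; rewrite (cardsD1 set0) -addn1 addnC leq_add ?leq_b1 //.
apply: leq_trans (max_card (mem (cover C))); rewrite -triv.
rewrite [leqRHS](bigID (pred1 set0)) /= -sum1_card.
apply: leq_trans (leq_addl _ _).
rewrite [leqLHS](eq_bigl (fun A => (A \in C) && (A != set0))) => [|A].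
  by apply: leq_sum => A /andP[_]; rewrite -card_gt0.
by rewrite !inE andbC.
Qed.

(* Units of the two upper digits of an item, counting the elements and the     *)
(* sets; the bases are large enough for sums of at most n + 2 items.           *)
Definition elt_weight (n : nat) : nat := n.+2 * 2 ^ n.
Definition set_weight (n : nat) : nat := n.+2 * (n.+2 * elt_weight n).
Definition item (n : nat) (A : {set 'I_n}) : nat :=
  set_weight n + \sum_(i in A) (elt_weight n + 2 ^ i).
Definition target (n t : nat) : nat :=
  t * set_weight n + \sum_(i < n) (elt_weight n + 2 ^ i).

Lemma targetE (n t : nat) :
  target n t = t * set_weight n + (n * elt_weight n + (2 ^ n - 1)).
Proof. by rewrite /target big_split /= sum_expn2 sum_nat_const card_ord. Qed.

Lemma sum_item (n : nat) (C : {set {set 'I_n}}) :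
  \sum_(A in C) item A = #|C| * set_weight n +
    ((\sum_(A in C) #|A|) * elt_weight n + \sum_(A in C) \sum_(i in A) 2 ^ i).
Proof.
rewrite big_split /= sum_nat_const; congr (_ + _).
rewrite big_distrl -big_split; apply: eq_bigr => A _ /=.
by rewrite big_split /= sum_nat_const.
Qed.

Lemma sum_expn2_set (n : nat) (A : {set 'I_n}) : \sum_(i in A) 2 ^ i <= 2 ^ n - 1.
Proof. by rewrite -sum_expn2 [leqRHS](bigID (mem A)) leq_addr. Qed.

Lemma digits_inj (b q q' r r' : nat) :
  r < b -> r' < b -> q * b + r = q' * b + r' -> q = q' /\ r = r'.
Proof.
move=> rb rb' eq.
have b0 : 0 < b by apply: leq_ltn_trans rb.
have qq' : q = q'.
  by move/(congr1 (divn^~ b)): eq; rewrite !divnMDl // !divn_small // !addn0.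
by split=> //; move: eq; rewrite qq' => /addnI.
Qed.

Lemma item_sum_digits (n t : nat) (C : {set {set 'I_n}}) : t <= n.+2 ->
  \sum_(A in C) item A = target n t ->
  [/\ #|C| = t, \sum_(A in C) #|A| = n
    & \sum_(A in C) \sum_(i in A) 2 ^ i = 2 ^ n - 1].
Proof.
rewrite sum_item targetE => le_t.
have card_le : \sum_(A in C) #|A| <= #|C| * n.
  by rewrite -sum_nat_const leq_sum // => A _; rewrite -[leqRHS]card_ord max_card.
have low_le : \sum_(A in C) \sum_(i in A) 2 ^ i <= #|C| * (2 ^ n - 1).
  by rewrite -sum_nat_const leq_sum // => A _; apply: sum_expn2_set.
have P0 : 0 < 2 ^ n by rewrite expn_gt0.
move: card_le low_le; rewrite /set_weight.
move: (\sum_(A in C) #|A|) (\sum_(A in C) \sum_(i in A) 2 ^ i) => s low card_le low_le.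
have BE : elt_weight n = n.+2 * 2 ^ n by [].
move: (elt_weight n) (2 ^ n) BE P0 low_le => B P BE P0 low_le.
have PB : P <= B by rewrite BE leq_pmull.
have rhs_lt : n * B + (P - 1) < n.+2 * (n.+2 * B).
  apply: (@leq_trans (n.+2 * B)); first by rewrite !mulSn; lia.
  by rewrite leq_pmull.
have bound x : x <= n.+2 -> low <= x * (P - 1) -> low < B.
  move=> le_x le_low; apply: leq_ltn_trans le_low _.
  apply: (@leq_ltn_trans (n.+2 * (P - 1))); first by rewrite leq_mul2r le_x orbT.
  by rewrite BE ltn_pmul2l //; lia.
move=> eq_sum.
(* The lower digits are known not to overflow only for few sets, so the size of [C] is bounded
   first: one set too many and the top digit alone exceeds the target. *)
have le_C : #|C| <= t.
  rewrite leqNgt; apply/negP => lt_t.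
  have := leq_mul lt_t (leqnn (n.+2 * (n.+2 * B))); rewrite [t.+1 * _]mulSn.
  by lia.
have le_C2 := leq_trans le_C le_t.
have low_lt := bound _ le_C2 low_le.
have lhs_lt : s * B + low < n.+2 * (n.+2 * B).
  apply: (@leq_trans ((n.+2 * n).+1 * B)).
    rewrite mulSn -addnS [leqRHS]addnC leq_add //.
    by rewrite leq_mul2r (leq_trans card_le) ?orbT // leq_mul2r le_C2 orbT.
  by rewrite mulnA leq_mul2r; apply/orP; right; rewrite [leqRHS]mulnS; lia.
have [eqC eq_low] := digits_inj lhs_lt rhs_lt eq_sum.
have P1B : P - 1 < B by lia.
by have [-> ->] := digits_inj low_lt P1B eq_low.
Qed.

(** For the converse, let [c i] be the number of members containing [i]. Double counting turns the
    two lower digits into the hypotheses of [sum_powers_no_carry], so each point lies in exactly one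
    member. *)
Lemma item_sumP (n t : nat) (C : {set {set 'I_n}}) : t <= n.+2 ->
  [&& #|C| == t, trivIset C & cover C == [set: 'I_n]] =
  (\sum_(A in C) item A == target n t).
Proof.
move=> le_t; apply/idP/eqP.
  case/and3P=> /eqP ct triv /eqP cov; rewrite /item big_split /= sum_nat_const ct.
  by rewrite -(big_trivIset _ triv) cov; under eq_bigl do rewrite inE.
move=> /(item_sum_digits le_t)[-> card_sum pow_sum]; rewrite eqxx /=.
pose c i := \sum_(A in C) \sum_(j in A) (val j == i).
have sum_c (w : nat -> nat) :
    \sum_(i < n) c i * w i = \sum_(A in C) \sum_(j in A) w j.
  under [LHS]eq_bigr do rewrite /c big_distrl /=.
  rewrite exchange_big; apply: eq_bigr => A _ /=.
  under [LHS]eq_bigr do rewrite big_distrl /=.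
  rewrite exchange_big /=; apply: eq_bigr => j _.
  rewrite (bigD1 j) //= eqxx mul1n big1 ?addn0 // => i.
  by rewrite -val_eqE eq_sym => /negbTE ->.
have c1 i : i < n -> c i = 1.
  apply: sum_powers_no_carry; first by rewrite sum_c.
  rewrite -[leqRHS]card_sum.
  under [leqLHS]eq_bigr do rewrite -[c _]muln1; rewrite (sum_c (fun=> 1)).
  by under [leqLHS]eq_bigr do rewrite sum1_card.
have cov : cover C = setT.
  apply/setP => i; rewrite inE; apply: contraT => icov.
  have := c1 i (ltn_ord i); rewrite /c big1 // => A AC; rewrite big1 // => j jA.
  case: eqP => // /val_inj ij; case/negP: icov; rewrite -ij.
  by apply/bigcupP; exists A.
(* [trivIset] is by definition the equality of the sum of the cardinalities with the cardinality of
   the cover. *)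
by rewrite cov eqxx andbT /trivIset cov cardsT card_ord card_sum.
Qed.

(** As [s] has no repetitions, sets of indices correspond to sets of elements of [s], even where [w]
    takes equal values. *)
Lemma subset_sum_image (T : finType) (s : seq T) (w : T -> nat) (v : nat) :
  uniq s ->
  [exists X : {set 'I_(size [seq w x | x <- s])},
     \sum_(i in X) nth 0 [seq w x | x <- s] i == v] =
  [exists C : {set T}, (C \subset s) && (\sum_(x in C) w x == v)].
Proof.
(* A nonempty list supplies the default [x0] for [nth]; [T] itself may be empty. *)
move=> uniq_s; case: s => [|x0 s'] in uniq_s *.
  have e0 (X : {set 'I_0}) : \sum_(i in X) nth 0 [::] i = 0.
    by apply: big1 => -[].
  apply/existsP/existsP => [[X /eqP <-]|[C /andP[/subsetP sub /eqP <-]]].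
    exists set0; rewrite big_set0 e0 eqxx andbT.
    by apply/subsetP => x; rewrite inE.
  by exists set0; rewrite big_set0 big1 // => x /sub.
set s := x0 :: s' in uniq_s *; clearbody s.
pose f (i : 'I_(size [seq w x | x <- s])) := nth x0 s i.
have lt_i (i : 'I_(size [seq w x | x <- s])) : i < size s by rewrite -(size_map w).
have f_inj : injective f.
  by move=> i j /eqP; rewrite nth_uniq // => /eqP/val_inj.
have sum_f (X : {set 'I_(size [seq w x | x <- s])}) :
    \sum_(i in X) nth 0 [seq w x | x <- s] i = \sum_(x in f @: X) w x.
  rewrite big_imset /= => [|i j _ _]; last exact: f_inj.
  by apply: eq_bigr => i _; rewrite (nth_map x0).
apply/existsP/existsP => [[X sumX]|[C /andP[/subsetP sub sumC]]].
  exists (f @: X); rewrite -sum_f sumX andbT.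
  by apply/subsetP => _ /imsetP[i _ ->]; apply: mem_nth.
exists (f @^-1: C); rewrite sum_f.
suff -> : f @: (f @^-1: C) = C by [].
apply/setP => x; apply/imsetP/idP => [[i]|xC]; first by rewrite inE => ? ->.
have lt_x : index x s < size [seq w x | x <- s] by rewrite size_map index_mem sub.
by exists (Ordinal lt_x); rewrite ?inE /f /= nth_index ?sub.
Qed.

(** * The machine *)

Lemma bitlen_leE (n L : nat) : 0 < L -> (bitlen n <= L) = (n < 2 ^ L).
Proof.
rewrite /bitlen => L0; case: n => [|n]; first by rewrite trunc_log0 L0 expn_gt0.
have /andP[lo hi] := trunc_log_bounds (isT : 1 < 2) (isT : 0 < n.+1).
apply/idP/idP => [le_L|lt_n].
  by apply: leq_trans hi _; rewrite leq_exp2l.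
by rewrite -(ltn_exp2l _ _ (isT : 1 < 2)); apply: leq_ltn_trans lo lt_n.
Qed.

Definition bounded (L : nat) (s : state) : Prop :=
  (forall x, regs s x < 2 ^ L) /\ (forall a, Defs.mem s a < 2 ^ L).

(* One instruction lengthens the numbers in the machine by at most one bit, so *)
(* counting the k instructions bounds the logarithmic cost and all values.     *)
Definition runs (c : cmd) (s s' : state) (k : nat) : Prop :=
  forall L, 0 < L -> bounded L s ->
  exists t, [/\ forall w, exec c s w s' w t, t <= 3 * k * (L + k)
              & bounded (L + k) s'].

Lemma bounded_weaken (L k : nat) (s : state) : bounded L s -> bounded (L + k) s.
Proof.
by case=> hr hm; split=> x; [apply: leq_trans (hr x) _ | apply: leq_trans (hm x) _];
  rewrite leq_exp2l // leq_addr.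
Qed.

Lemma bounded_setr (L x v : nat) (s : state) :
  bounded L s -> v < 2 ^ L -> bounded L (setr s x v).
Proof. by case=> hr hm hv; split=> y //=; rewrite /upd; case: ifP. Qed.

Lemma bounded_setm (L a v : nat) (s : state) :
  bounded L s -> v < 2 ^ L -> bounded L (setm s a v).
Proof. by case=> hr hm hv; split=> y //=; rewrite /upd; case: ifP. Qed.

Lemma bounded_reg (L x : nat) (s : state) :
  0 < L -> bounded L s -> bitlen (regs s x) <= L.
Proof. by move=> L0 [hr _]; rewrite bitlen_leE. Qed.

Lemma bounded_mem (L a : nat) (s : state) :
  0 < L -> bounded L s -> bitlen (Defs.mem s a) <= L.
Proof. by move=> L0 [_ hm]; rewrite bitlen_leE. Qed.

Lemma runs_weaken (c : cmd) (s s' : state) (k k' : nat) :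
  k <= k' -> runs c s s' k -> runs c s s' k'.
Proof.
move=> kk' H L L0 /(H _ L0)[t [ht hc hb]]; exists t; split=> //.
  by apply: leq_trans hc _; rewrite leq_mul // ?leq_mul // leq_add2l.
by rewrite -(subnKC kk') addnA; apply: bounded_weaken.
Qed.

Lemma runs_skip (s : state) : runs Skip s s 1.
Proof.
move=> L L0 hb; exists 1; split; [exact: exec_skip | lia | exact: bounded_weaken].
Qed.

Lemma runs_const (x c : nat) (s : state) :
  c <= 2 -> runs (Const x c) s (setr s x c) 1.
Proof.
move=> c2 L L0 hb; exists (bitlen c); split; first exact: exec_const.
  have : bitlen c <= 2 by rewrite bitlen_leE //; lia.
  lia.
apply: bounded_setr; first exact: bounded_weaken.
by apply: leq_trans (_ : 2 ^ 2 <= _); [lia | rewrite leq_exp2l //; lia].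
Qed.

Lemma runs_add (x y z : nat) (s : state) :
  runs (Add x y z) s (setr s x (regs s y + regs s z)) 1.
Proof.
move=> L L0 hb; eexists; split; first exact: exec_add.
  have := bounded_reg y L0 hb; have := bounded_reg z L0 hb; lia.
apply: bounded_setr; first exact: bounded_weaken.
case: hb => hr _; have := hr y; have := hr z; rewrite expnD; lia.
Qed.

Lemma runs_sub (x y z : nat) (s : state) :
  runs (Defs.Sub x y z) s (setr s x (regs s y - regs s z)) 1.
Proof.
move=> L L0 hb; eexists; split; first exact: exec_sub.
  have := bounded_reg y L0 hb; have := bounded_reg z L0 hb; lia.
apply: bounded_setr; first exact: bounded_weaken.
case: hb => hr _; have := hr y; rewrite expnD; lia.
Qed.

Lemma runs_read (x y : nat) (s : state) :
  runs (Read x y) s (setr s x (Defs.mem s (regs s y))) 1.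
Proof.
move=> L L0 hb; eexists; split; first exact: exec_read.
  have := bounded_reg y L0 hb; have := bounded_mem (regs s y) L0 hb; lia.
apply: bounded_setr; first exact: bounded_weaken.
case: hb => _ hm; have := hm (regs s y); rewrite expnD; lia.
Qed.

Lemma runs_write (x y : nat) (s : state) :
  runs (Write x y) s (setm s (regs s x) (regs s y)) 1.
Proof.
move=> L L0 hb; eexists; split; first exact: exec_write.
  have := bounded_reg x L0 hb; have := bounded_reg y L0 hb; lia.
apply: bounded_setm; first exact: bounded_weaken.
case: hb => hr _; have := hr y; rewrite expnD; lia.
Qed.

(** The second command starts with numbers of up to [L + k1] bits; the quadratic form of the cost
    bound absorbs this growth. *)
Lemma runs_seq (c1 c2 : cmd) (s s1 s2 : state) (k1 k2 : nat) :
  runs c1 s s1 k1 -> runs c2 s1 s2 k2 -> runs (Seq c1 c2) s s2 (k1 + k2).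
Proof.
move=> H1 H2 L L0 /(H1 _ L0)[t1 [e1 b1]].
have L1 : 0 < L + k1 by rewrite addn_gt0 L0.
move=> /(H2 _ L1)[t2 [e2 b2 hb]]; exists (t1 + t2); split; last by rewrite addnA.
  by move=> w; apply: exec_seq.
by nia.
Qed.

Lemma runs_if (x : nat) (c1 c2 : cmd) (s s' : state) (k : nat) :
  runs (if regs s x != 0 then c1 else c2) s s' k ->
  runs (If x c1 c2) s s' k.+1.
Proof.
move=> H L L0 hb; have [t [e ht hb']] := H L L0 hb.
exists (bitlen (regs s x) + t); split; first by move=> w; apply: exec_if.
  have hx := bounded_reg x L0 hb.
  have := leq_mul (leqnn (3 * k)) (leq_addr 1 (L + k)).
  rewrite -addnA addn1 [3 * k.+1]mulnS mulnDl; lia.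
by rewrite -addn1 addnA; apply: bounded_weaken.
Qed.

(** [S i] is the state after [i] rounds. The induction is on the number [m] of rounds still to come,
    hence the states [S (n - m)]. *)
Lemma runs_while (x n k : nat) (c : cmd) (S : nat -> state) :
  (forall i, regs (S i) x = n - i) ->
  (forall i, i < n -> runs c (S i) (S i.+1) k) ->
  runs (While x c) (S 0) (S n) (n * k.+1).+1.
Proof.
move=> hx hc; suff H m : m <= n -> runs (While x c) (S (n - m)) (S n) (m * k.+1).+1.
  by have := H n (leqnn n); rewrite subnn.
elim: m => [_ L L0 hb|m IH lt_mn L L0 hb].
  have rx : regs (S n) x = 0 by rewrite hx subnn.
  rewrite subn0 in hb *; exists (bitlen (regs (S n) x)); split.
  - by move=> w; apply: exec_while_stop.
  - have := bounded_reg x L0 hb; lia.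
  - exact: bounded_weaken.
have [|t1 [e1 h1 b1]] := hc (n - m.+1) _ L L0 hb; first by lia.
have eS : (n - m.+1).+1 = n - m by lia.
rewrite eS in e1 b1.
have L1 : 0 < L + k by rewrite addn_gt0 L0.
have [t2 [e2 h2 b2]] := IH (ltnW lt_mn) _ L1 b1.
exists (bitlen (regs (S (n - m.+1)) x) + t1 + t2); split.
- by move=> w; apply: exec_while_step; [rewrite hx; lia | exact: e1 | exact: e2].
- have := bounded_reg x L0 hb; move: h1 h2; rewrite [m.+1 * _]mulSn.
  move: (m * k.+1) => q h1 h2 hr.
  have h1' : t1 <= 3 * k * (L + (k.+1 + q).+1) by apply: leq_trans h1 _; rewrite leq_mul //; lia.
  have h2' : t2 <= 3 * q.+1 * (L + (k.+1 + q).+1).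
    by apply: leq_trans h2 _; rewrite leq_mul //; lia.
  have -> : 3 * (k.+1 + q).+1 = 3 * k + 3 * q.+1 + 3 by lia.
  rewrite 2!mulnDl; lia.
- have -> : L + (m.+1 * k.+1).+1 = L + k + (m * k.+1).+1 + 1 by lia.
  exact: bounded_weaken.
Qed.

(** * Register lists and the layout of memory *)

(** With the registers in a list, register updates compute by simplification; registers beyond the
    list hold 0. *)
Definition st (l : seq nat) (m : nat -> nat) : state := State (nth 0 l) m.

Lemma setr_st (l : seq nat) (m : nat -> nat) (x v : nat) :
  setr (st l m) x v = st (set_nth 0 l x v) m.
Proof. by congr State; apply/funext => y; rewrite nth_set_nth. Qed.

(* Memory during the reduction: below p the output written so far, padded with *)
(* zeros, and from p on the part of the input that has not been read yet.      *)
Definition tape (out : seq nat) (p : nat) (rest : seq nat) : nat -> nat :=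
  fun a => if a < p then nth 0 out a else nth 0 rest (a - p).

Lemma tape_read (out : seq nat) (p : nat) (rest : seq nat) :
  tape out p rest p = nth 0 rest 0.
Proof. by rewrite /tape ltnn subnn. Qed.

(** Zeroing the cell just read extends the padding after the output, which does not reach position
    [p]. *)
Lemma tape_erase (out : seq nat) (p : nat) (rest : seq nat) :
  size out <= p -> upd (tape out p rest) p 0 = tape out p.+1 (behead rest).
Proof.
move=> le_p; apply/funext => a; rewrite /upd /tape ltnS nth_behead.
case: (ltngtP a p) => [//|lt_pa|->]; first by congr nth; lia.
by rewrite nth_default.
Qed.

(** The strict inequality says that the cell written has already been read, so no pending input is
    lost. *)
Lemma tape_write (out : seq nat) (p v : nat) (rest : seq nat) :
  size out < p -> upd (tape out p rest) (size out) v = tape (rcons out v) p rest.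
Proof.
move=> lt_p; apply/funext => a; rewrite /upd /tape nth_rcons.
case: (ltngtP a (size out)) => [//|lt_a|->]; last by rewrite lt_p.
by case: ifP => // _; rewrite nth_default // ltnW.
Qed.

(** * The program of the reduction *)

Section Program.
Local Notation rN := 0.
Local Notation rT := 1.
Local Notation rF := 2.
Local Notation rOne := 3.
Local Notation rElt := 4.
Local Notation rSet := 5.
Local Notation rTarget := 6.
Local Notation rPow := 7.
Local Notation rIn := 8.
Local Notation rOut := 9.
Local Notation rAcc := 10.
Local Notation rI := 11.
Local Notation rTmp := 12.
Local Notation rBit := 13.
Local Notation "c1 ;; c2" := (Seq c1 c2) (at level 80, right associativity).

Definition For (x : nat) (c : cmd) : cmd := While x (c ;; Defs.Sub x x rOne).

(** [rAcc] is 0 here and erases the cells read. The conditional computes [capN], the last two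
    subtractions [capT]. *)
Definition load : cmd :=
  Const rOne 1 ;;
  Read rN rIn ;; Write rIn rAcc ;; Add rIn rIn rOne ;;
  Read rT rIn ;; Write rIn rAcc ;; Add rIn rIn rOne ;;
  Read rF rIn ;; Write rIn rAcc ;; Add rIn rIn rOne ;;
  If rF Skip (Defs.Sub rTmp rN rOne ;; Defs.Sub rN rN rTmp) ;;
  Add rTmp rN rOne ;; Add rTmp rTmp rOne ;;
  Defs.Sub rI rT rTmp ;; Defs.Sub rT rT rI.

(* The machine has no copy instruction: here rAcc, and in write_item rTmp,      *)
(* holds 0, so that adding it copies the other register.                       *)
Definition weights : cmd :=
  Add rElt rTmp rAcc ;; Add rI rN rAcc ;;
  For rI (Add rElt rElt rElt) ;;
  Add rI rTmp rAcc ;;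
  For rI (Add rPow rPow rElt) ;;
  Add rI rTmp rAcc ;;
  For rI (Add rSet rSet rPow).

(** Multiplication by [t] is repeated addition, affordable since [load] has cut [t] down to at most
    [n + 2]. *)
Definition write_header : cmd :=
  For rT (Add rTarget rTarget rSet) ;;
  Add rI rN rAcc ;; Const rPow 1 ;;
  For rI (Add rTarget rTarget rElt ;; Add rTarget rTarget rPow ;;
          Add rPow rPow rPow) ;;
  Write rOut rF ;; Add rOut rOut rOne ;;
  Write rOut rTarget ;; Add rOut rOut rOne.

Definition read_bit : cmd :=
  Read rBit rIn ;;
  If rBit (Add rAcc rAcc rElt ;; Add rAcc rAcc rPow) Skip ;;
  Write rIn rTmp ;; Add rIn rIn rOne ;; Add rPow rPow rPow ;; Const rBit 0.

Definition write_item : cmd :=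
  Add rAcc rSet rTmp ;; Const rPow 1 ;; Add rI rN rTmp ;;
  For rI read_bit ;;
  Write rOut rAcc ;; Add rOut rOut rOne ;; Const rAcc 0.

(** A program appended to the reduction expects all registers to be zero. *)
Definition clear (x : nat) : cmd := foldr (fun i c => Const i 0 ;; c) Skip (iota 0 x).

Definition reduction : cmd :=
  load ;; weights ;; write_header ;; (Const rTmp 0 ;; For rF write_item) ;; clear 14.

(** * Symbolic execution of the program *)

Lemma runs_Const (x v : nat) (l : seq nat) (m : nat -> nat) : v <= 2 ->
  runs (Const x v) (st l m) (st (set_nth 0 l x v) m) 1.
Proof. by move=> hv; rewrite -setr_st; apply: runs_const. Qed.

Lemma runs_Add (x y z : nat) (l : seq nat) (m : nat -> nat) :
  runs (Add x y z) (st l m) (st (set_nth 0 l x (nth 0 l y + nth 0 l z)) m) 1.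
Proof. by rewrite -setr_st; apply: runs_add. Qed.

Lemma runs_Sub (x y z : nat) (l : seq nat) (m : nat -> nat) :
  runs (Defs.Sub x y z) (st l m) (st (set_nth 0 l x (nth 0 l y - nth 0 l z)) m) 1.
Proof. by rewrite -setr_st; apply: runs_sub. Qed.

Lemma runs_Read (x y : nat) (l : seq nat) (m : nat -> nat) :
  runs (Read x y) (st l m) (st (set_nth 0 l x (m (nth 0 l y))) m) 1.
Proof. by rewrite -setr_st; apply: runs_read. Qed.

Lemma runs_Write (x y : nat) (l : seq nat) (m : nat -> nat) :
  runs (Write x y) (st l m) (st l (upd m (nth 0 l x) (nth 0 l y))) 1.
Proof. exact: runs_write. Qed.

Lemma runs_If (x : nat) (c1 c2 : cmd) (l : seq nat) (m : nat -> nat) (s : state) (k : nat) :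
  runs (if nth 0 l x != 0 then c1 else c2) (st l m) s k ->
  runs (If x c1 c2) (st l m) s k.+1.
Proof. exact: runs_if. Qed.

(** Lets execution synthesise the final state and the step count, which are compared with the stated
    ones afterwards. *)
Lemma runs_eq (c : cmd) (s s1 s2 : state) (k k' : nat) :
  runs c s s1 k -> s1 = s2 -> k <= k' -> runs c s s2 k'.
Proof. by move=> h <- /runs_weaken; apply. Qed.

(** In [l i j] the round [i] and the counter value [j] are independent, so the body is verified for
    an arbitrary counter. The two extra steps per round are the test and the decrement. *)
Lemma runs_For (x n k : nat) (c : cmd) (l : nat -> nat -> seq nat)
    (m : nat -> nat -> nat) (l0 : seq nat) (m0 : nat -> nat) :
  l0 = l 0 n -> m0 = m 0 ->
  (forall i j, nth 0 (l i j) x = j) ->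
  (forall i j, nth 0 (l i j) rOne = 1) ->
  (forall i j j', set_nth 0 (l i j) x j' = l i j') ->
  (forall i j, i < n -> runs c (st (l i j) (m i)) (st (l i.+1 j) (m i.+1)) k) ->
  runs (For x c) (st l0 m0) (st (l n 0) (m n)) (n * k.+2).+1.
Proof.
move=> -> -> hx h1 hset hc.
have := @runs_while x n k.+1 (c ;; Defs.Sub x x rOne) (fun i => st (l i (n - i)) (m i)).
rewrite subn0 subnn; apply=> [i|i lt_i]; first exact: hx.
rewrite -[k.+1]addn1; apply: runs_seq (hc _ _ lt_i) _.
have := @runs_Sub x x rOne (l i.+1 (n - i)) (m i.+1).
by rewrite hx h1 subn1 -subnS hset.
Qed.

Ltac step :=
  first [ exact: runs_Add | exact: runs_Sub | exact: runs_Read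
        | exact: runs_Write | exact: runs_Const | exact: runs_skip ].
Ltac steps := repeat (eapply runs_seq; [step | rewrite /=]); try step.

(* If the family is empty, n may be exponential in the input size; only n = 0  *)
(* matters then. Likewise t is cut down to n + 2: no partition has more than   *)
(* n + 1 members, the empty set included.                                      *)
Definition capN (n f : nat) : nat := if f == 0 then n - (n - 1) else n.
Definition capT (n t : nat) : nat := t - (t - n.+2).

Lemma capT_le (n t : nat) : capT n t <= n.+2.
Proof. by rewrite /capT; lia. Qed.

Lemma runs_load (n t f : nat) (r : seq nat) :
  let n' := capN n f in
  runs load (init [:: n, t, f & r])
    (st [:: n'; capT n' t; f; 1; 0; 0; 0; 0; 3; 0; 0; t - n'.+2; n'.+2; 0]
        (tape [::] 3 r)) 20.
Proof.
move=> n'.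
have -> : init [:: n, t, f & r] = st (nseq 14 0) (tape [::] 0 [:: n, t, f & r]).
  congr State; apply/funext => x; first by rewrite nth_nseq if_same.
  by rewrite /tape subn0.
eapply runs_eq.
- rewrite /load /=; do 10 (eapply runs_seq; [step | rewrite /= ?tape_read ?tape_erase //=]).
  (* Both branches are brought to a common state, in which [rTmp] may keep a leftover, in 3 steps:
     the test and at most two instructions. *)
  eapply (@runs_seq _ _ _ (st [:: n'; t; f; 1; 0; 0; 0; 0; 3; 0; 0; 0;
    if f == 0 then n - 1 else 0; 0] (tape [::] 3 r)) _ 3).
    apply: runs_If; rewrite /= /n' /capN; case: eqP => _ /=; last first.
      by apply: runs_weaken (_ : 1 <= 2) _ => //; apply: runs_skip.
    by apply: (@runs_seq _ _ _ _ _ 1 1); step.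
  by steps.
- by rewrite /= !addn1.
- by [].
Qed.

Lemma runs_weights (n t f : nat) (u : nat) (m : nat -> nat) :
  runs weights
    (st [:: n; t; f; 1; 0; 0; 0; 0; 3; 0; 0; u; n.+2; 0] m)
    (st [:: n; t; f; 1; elt_weight n; set_weight n; 0; n.+2 * elt_weight n;
            3; 0; 0; 0; n.+2; 0] m) (10 * n.+3).
Proof.
eapply runs_eq.
- rewrite /weights /=; do 2 (eapply runs_seq; [step | rewrite /=]).
  eapply runs_seq.
    apply: (@runs_For rI n _ _ (fun i j =>
      [:: n; t; f; 1; n.+2 * 2 ^ i; 0; 0; 0; 3; 0; 0; j; n.+2; 0]) (fun=> m)) => //=.
      by rewrite muln1 !addn0.
    by move=> i j _; eapply runs_eq; [step | rewrite /= addnn -mul2n mulnCA expnS | exact: leqnn].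
  eapply runs_seq; first step.
  eapply runs_seq.
    apply: (@runs_For rI n.+2 _ _ (fun i j =>
      [:: n; t; f; 1; elt_weight n; 0; 0; i * elt_weight n; 3; 0; 0; j; n.+2; 0]) (fun=> m)) => //=.
      by rewrite addn0.
    by move=> i j _; eapply runs_eq; [step | rewrite /= [i.+1 * _]mulSnr | exact: leqnn].
  eapply runs_seq; first step.
  apply: (@runs_For rI n.+2 _ _ (fun i j =>
    [:: n; t; f; 1; elt_weight n; i * (n.+2 * elt_weight n); 0;
        n.+2 * elt_weight n; 3; 0; 0; j; n.+2; 0]) (fun=> m)) => //=.
    by rewrite addn0.
  by move=> i j _; eapply runs_eq; [step | rewrite /= [i.+1 * _]mulSnr | exact: leqnn].
- by [].
- lia.
Qed.

Lemma runs_write_header (n t f : nat) (r : seq nat) :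
  runs write_header
    (st [:: n; t; f; 1; elt_weight n; set_weight n; 0; n.+2 * elt_weight n;
            3; 0; 0; 0; n.+2; 0] (tape [::] 3 r))
    (st [:: n; 0; f; 1; elt_weight n; set_weight n; target n t; 2 ^ n;
            3; 2; 0; 0; n.+2; 0] (tape [:: f; target n t] 3 r))
    (10 * (n + t).+3).
Proof.
eapply runs_eq.
- rewrite /write_header.
  eapply runs_seq.
    apply: (@runs_For rT t _ _ (fun i j =>
      [:: n; j; f; 1; elt_weight n; set_weight n; i * set_weight n;
          n.+2 * elt_weight n; 3; 0; 0; 0; n.+2; 0]) (fun=> tape [::] 3 r)) => //=.
    by move=> i j _; eapply runs_eq; [step | rewrite /= [i.+1 * _]mulSnr | exact: leqnn].
  do 2 (eapply runs_seq; first step).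
  eapply runs_seq.
    apply: (@runs_For rI n _ _ (fun i j =>
      [:: n; 0; f; 1; elt_weight n; set_weight n;
          t * set_weight n + \sum_(h < i) (elt_weight n + 2 ^ h);
          2 ^ i; 3; 0; 0; j; n.+2; 0]) (fun=> tape [::] 3 r)) => //=.
      by rewrite big_ord0 !addn0.
    move=> i j _; eapply runs_eq; [steps | | exact: leqnn].
    by rewrite /= big_ord_recr /= !addnA expnS mul2n -addnn.
  by steps.
- rewrite /= -/(target n t); congr st.
  by rewrite (@tape_write [::]) // (@tape_write [:: f]).
- lia.
Qed.

Lemma runs_read_bit (n c v pin pout acc i j : nat) (out r : seq nat) :
  size out <= pin ->
  runs read_bit
    (st [:: n; 0; c; 1; elt_weight n; set_weight n; v; 2 ^ i;
            pin; pout; acc; j; 0; 0] (tape out pin r))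
    (st [:: n; 0; c; 1; elt_weight n; set_weight n; v; 2 ^ i.+1;
            pin.+1; pout; acc + (nth 0 r 0 != 0) * (elt_weight n + 2 ^ i);
            j; 0; 0] (tape out pin.+1 (behead r))) 8.
Proof.
move=> le_pin; eapply runs_eq.
- rewrite /read_bit; eapply runs_seq; [step | rewrite /= tape_read].
  eapply (@runs_seq _ _ _ (st [:: n; 0; c; 1; elt_weight n; set_weight n; v; 2 ^ i;
      pin; pout; acc + (nth 0 r 0 != 0) * (elt_weight n + 2 ^ i); j; 0; nth 0 r 0]
      (tape out pin r)) _ 3).
    apply: runs_If => /=; case: eqP => [->|_] /=.
      by rewrite mul0n addn0; apply: runs_weaken (_ : 1 <= 2) _ => //; apply: runs_skip.
    by rewrite mul1n addnA; apply: (@runs_seq _ _ _ _ _ 1 1); step.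
  eapply runs_seq; [step | rewrite /= tape_erase //].
  by steps.
- by rewrite /= addn1 addnn -mul2n -expnS.
- by [].
Qed.

(** The value computed from an arbitrary row; on a characteristic vector it is [item]. *)
Definition row_item (n : nat) (r : seq nat) : nat :=
  set_weight n + \sum_(i < n) (nth 0 r i != 0) * (elt_weight n + 2 ^ i).

Lemma runs_write_item (n c v pin : nat) (out r : seq nat) :
  size out <= pin -> size out < pin + n ->
  runs write_item
    (st [:: n; 0; c; 1; elt_weight n; set_weight n; v; 2 ^ n;
            pin; size out; 0; 0; 0; 0] (tape out pin r))
    (st [:: n; 0; c; 1; elt_weight n; set_weight n; v; 2 ^ n;
            pin + n; (size out).+1; 0; 0; 0; 0]
        (tape (rcons out (row_item n r)) (pin + n) (drop n r))) (10 * n + 7).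
Proof.
move=> le_pin lt_pin; eapply runs_eq.
- rewrite /write_item; do 3 (eapply runs_seq; [step | rewrite /=]).
  eapply runs_seq.
    apply: (@runs_For rI n _ _ (fun i j =>
      [:: n; 0; c; 1; elt_weight n; set_weight n; v; 2 ^ i; pin + i; size out;
          set_weight n + \sum_(h < i) (nth 0 r h != 0) * (elt_weight n + 2 ^ h);
          j; 0; 0]) (fun i => tape out (pin + i) (drop i r))) => //=.
    + by rewrite big_ord0 !addn0.
    + by rewrite addn0 drop0.
    + move=> i j lt_i; eapply runs_eq; [apply: runs_read_bit | | exact: leqnn].
        by apply: leq_trans le_pin _; apply: leq_addr.
      by rewrite nth_drop addn0 big_ord_recr addnA addnS -drop1 drop_drop add1n.
  eapply runs_seq; [step | rewrite /= tape_write //].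
  by steps.
- by rewrite /= addn1.
- lia.
Qed.

Definition row_items (n f : nat) (r : seq nat) : seq nat :=
  mkseq (fun j => row_item n (drop (j * n) r)) f.

(** When item [i] is written, [i + 2] cells are occupied and [3 + (i + 1) * n] have been read.
    Writing stays behind reading if rows are nonempty, or if there is at most one row. *)
Lemma runs_write_items (n f v : nat) (r : seq nat) :
  (0 < n) || (f <= 1) ->
  runs (For rF write_item)
    (st [:: n; 0; f; 1; elt_weight n; set_weight n; v; 2 ^ n;
            3; 2; 0; 0; 0; 0] (tape [:: f; v] 3 r))
    (st [:: n; 0; 0; 1; elt_weight n; set_weight n; v; 2 ^ n;
            3 + f * n; f.+2; 0; 0; 0; 0]
        (tape [:: f, v & row_items n f r] (3 + f * n) (drop (f * n) r)))
    (f * (10 * n + 9)).+1.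
Proof.
move=> n_or_f; rewrite -[9]/(7 + 2) addnA addn2.
apply: (@runs_For rF f _ _ (fun i j =>
  [:: n; 0; j; 1; elt_weight n; set_weight n; v; 2 ^ n; 3 + i * n; i.+2; 0; 0; 0; 0])
  (fun i => tape [:: f, v & row_items n i r] (3 + i * n) (drop (i * n) r))) => //=.
  by rewrite drop0.
move=> i j lt_i.
have := @runs_write_item n j v (3 + i * n) [:: f, v & row_items n i r] (drop (i * n) r).
have lt_in : i < (i * n + n).+1.
  case: n n_or_f => [|n] /=; last by rewrite mulnS; lia.
  by case: i lt_i => // i lt_i; lia.
have le_in : i <= (i * n).+1.
  case: n n_or_f {lt_in} => [|n] /=; last by rewrite mulnS; lia.
  by case: i lt_i => // i lt_i; lia.
rewrite /= size_mkseq => H; eapply runs_eq; [apply: H | | exact: leqnn].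
- by rewrite !addSn !ltnS.
- by rewrite !addSn !ltnS.
- by rewrite /row_items mkseqS /= mulSnr addnA drop_drop [n + _]addnC.
Qed.

Lemma runs_clear (l : seq nat) (m : nat -> nat) :
  size l = 14 -> runs (clear 14) (st l m) (State (fun=> 0) m) 15.
Proof.
do 14 (case: l => // ? l); case: l => // _.
have -> : State (fun=> 0) m = st (nseq 14 0) m.
  by congr State; apply/funext => x; rewrite nth_nseq if_same.
rewrite /clear /=.
by eapply runs_eq; [steps | | exact: leqnn].
Qed.

Lemma runs_reduction (n t f : nat) (r : seq nat) :
  let n' := capN n f in
  (0 < n') || (f <= 1) -> size r <= f * n' ->
  runs reduction (init [:: n, t, f & r])
    (init [:: f, target n' (capT n' t) & row_items n' f r])
    (200 * (n' + f + f * n').+1).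
Proof.
move=> n' n_or_f size_r.
have le_f : f <= (f * n').+1.
  by move: n_or_f; rewrite /n'; case: (capN n f) => [|m]; [lia | rewrite mulnS; lia].
eapply runs_eq.
- rewrite /reduction; eapply runs_seq; first exact: runs_load.
  eapply runs_seq; first exact: runs_weights.
  eapply runs_seq; first exact: runs_write_header.
  eapply runs_seq.
    by eapply runs_seq; [step | apply: runs_write_items].
  exact: runs_clear.
(* All input has been consumed, so memory holds the output and zeros only. *)
- congr State; apply/funext => a; rewrite /tape drop_oversize // nth_nil.
  case: ltnP => // le_a; rewrite nth_default //= size_mkseq.
  by apply: leq_trans le_a.
- rewrite -/n' [f * (_ + _)]mulnDr [f * (10 * _)]mulnCA.
  have := capT_le n' t; move: (capT n' t) (f * n') => u q.
  move: (n') => m; lia.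
Qed.
End Program.

(** * Correctness and cost of the reduction *)

Lemma nth_flatten_uniform (n : nat) (rows : seq (seq nat)) (j i : nat) :
  all (fun row => size row == n) rows -> i < n ->
  nth 0 (flatten rows) (j * n + i) = nth 0 (nth [::] rows j) i.
Proof.
elim: rows j => [|row rows IH] [|j] //=; rewrite ?nth_nil // => /andP[/eqP size_row all_n] lt_i.
  by rewrite nth_cat size_row mul0n add0n lt_i.
rewrite nth_cat size_row mulSn ifN; last by rewrite -leqNgt -addnA leq_addr.
by rewrite -[n + j * n + i]addnA addKn IH.
Qed.

Definition bits (n : nat) (A : {set 'I_n}) : seq nat :=
  [seq nat_of_bool (i \in A) | i <- enum 'I_n].

Lemma size_bits (n : nat) (A : {set 'I_n}) : size (bits A) = n.
Proof. by rewrite size_map size_enum_ord. Qed.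

Lemma nth_bits (n : nat) (A : {set 'I_n}) (i : 'I_n) : nth 0 (bits A) i = (i \in A).
Proof. by rewrite (nth_map i) ?size_enum_ord // nth_ord_enum. Qed.

Lemma size_flatten_bits (n : nat) (F : seq {set 'I_n}) :
  size (flatten [seq bits A | A <- F]) = size F * n.
Proof. by elim: F => //= A F IH; rewrite size_cat size_bits IH mulSn. Qed.

Lemma row_items_bits (n : nat) (F : seq {set 'I_n}) :
  row_items n (size F) (flatten [seq bits A | A <- F]) = [seq item A | A <- F].
Proof.
apply: (@eq_from_nth _ 0) => [|j]; first by rewrite size_mkseq size_map.
rewrite size_mkseq => lt_j; rewrite nth_mkseq // (nth_map set0) //.
congr (_ + _); rewrite [RHS]big_mkcond; apply: eq_bigr => i _.
rewrite nth_drop nth_flatten_uniform //; last first.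
  by apply/allP => _ /mapP[A _ ->]; rewrite size_bits.
by rewrite (nth_map set0) // nth_bits; case: (_ \in _); rewrite ?mul1n ?mul0n.
Qed.

Lemma target_eq0 (n t : nat) : (target n t == 0) = (t == 0) && (n == 0).
Proof.
rewrite targetE !addn_eq0 !muln_eq0 expn_eq0 /= !orbF.
by case: n => [|n]; rewrite ?andbF.
Qed.

(** The counter for sets makes even the item of the empty set positive. *)
Lemma row_items_pos (n f : nat) (r : seq nat) : all (fun a => 0 < a) (row_items n f r).
Proof.
apply/allP => _ /mapP[j _ ->].
by rewrite addn_gt0 /set_weight /elt_weight !muln_gt0 expn_gt0.
Qed.

(** Phrased as the literal output of the program; [reduce_items] recovers the items of the sets. *)
Definition reduce (k : nat) (x : set_partitioning_instance k) : subset_sum_instance :=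
  let f := size (sp_family x) in
  let n := capN (sp_n x) f in
  SubsetSumInstance (target n (capT n (sp_target x)))
    (row_items_pos n f (flatten [seq bits A | A <- sp_family x])).

Lemma reduce_items (k : nat) (x : set_partitioning_instance k) :
  ss_items (reduce x) = [seq item A | A <- sp_family x].
Proof.
case: x => n t [|A F] //= uniq_F size_F.
exact: (row_items_bits (A :: F)).
Qed.

Lemma ss_answer_reduce (k : nat) (x : set_partitioning_instance k) :
  ss_answer (reduce x) = sp_answer x.
Proof.
rewrite /ss_answer reduce_items subset_sum_image; last exact: sp_family_uniq.
rewrite /sp_answer; apply: eq_existsb => C; case: (boolP (C \subset _)) => //= sub.
(* With an empty family only the empty [C] remains, and both sides say that [t] and [n] are 0. *)
rewrite /capN; case: x => n t [|A F] /= uniq_F size_F in C sub *.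
  have -> : C = set0 by apply/setP => B; rewrite inE; apply/negP => /(subsetP sub).
  rewrite big_set0 cards0 eq_sym target_eq0 /trivIset /cover !big_set0 cards0 eqxx /=.
  have -> : (set0 == [set: 'I_n]) = (n == 0).
    by rewrite eq_sym -cards_eq0 cardsT card_ord.
  rewrite /capT; case: n {C uniq_F size_F sub} => [|n]; lia.
rewrite -item_sumP; last by rewrite capT_le.
case: (boolP (trivIset C)) => [triv|]; last by rewrite !andbF.
(* With at most [n + 1] members, having [t] of them and having [capT n t] of them are equivalent. *)
have := card_trivIset triv; rewrite card_ord => card_C.
congr (_ && _); rewrite /capT; move: #|C| card_C => m le_m. lia.
Qed.

Lemma le_exp_bitlen (v : nat) : 2 ^ bitlen v <= 2 * v.+1.
Proof.
case: v => [|v]; first by rewrite /bitlen trunc_log0.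
have := trunc_logP (isT : 1 < 2) (isT : 0 < v.+1); rewrite /bitlen expnS; lia.
Qed.

Lemma size_le_input_size (s : seq nat) : size s <= \sum_(v <- s) bitlen v.
Proof. by rewrite -sum1_size; apply: leq_sum. Qed.

Lemma bitlen_le_input_size (s : seq nat) (v : nat) :
  v \in s -> bitlen v <= \sum_(u <- s) bitlen u.
Proof. by move=> v_s; rewrite (big_rem v) //= leq_addr. Qed.

(** The target is below [t.+1 * set_weight n], and [set_weight n] is [n.+2 ^ 3 * 2 ^ n]. This is the
    multiplicative form of [n + O(log n)] bits. *)
Lemma target_bitlen (n t : nat) : t <= n.+2 ->
  2 ^ bitlen (target n t) <= 2 * n.+3 ^ 4 * 2 ^ n.
Proof.
move=> le_t; apply: leq_trans (le_exp_bitlen _) _; rewrite -mulnA leq_mul2l /=.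
have P0 : 0 < 2 ^ n by rewrite expn_gt0.
have lt_D : n * elt_weight n + (2 ^ n - 1) < set_weight n.
  apply: (@leq_trans (n.+2 * elt_weight n)); last by rewrite leq_pmull.
  have PB : 2 ^ n <= elt_weight n by rewrite leq_pmull.
  by rewrite !mulSn; lia.
apply: (@leq_trans (t.+1 * set_weight n)).
  by rewrite targetE -addnS mulSn addnC leq_add.
rewrite /set_weight /elt_weight !expnS expn0 muln1 -!mulnA.
by rewrite !leq_mul.
Qed.

Lemma sp_encodeE (k : nat) (x : set_partitioning_instance k) :
  sp_encode x = [:: sp_n x, sp_target x, size (sp_family x) &
                    flatten [seq bits A | A <- sp_family x]].
Proof. by []. Qed.

Lemma mul_capN (n f : nat) : f * capN n f = f * n.
Proof. by rewrite /capN; case: eqP => // ->. Qed.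

Lemma capN_le (n f : nat) : capN n f <= n.
Proof. by rewrite /capN; case: ifP => // _; lia. Qed.

(** Every number of the encoding costs at least one bit. Over an empty universe a family without
    repetitions has at most one member, the empty set. *)
Lemma sp_size_bounds (k : nat) (x : set_partitioning_instance k) :
  let f := size (sp_family x) in let n := capN (sp_n x) f in
  let N := input_size (Pi := set_partitioning k) x in
  [/\ (0 < n) || (f <= 1), n <= N, f <= N & f * n <= N].
Proof.
have /= := size_le_input_size (sp_encode x).
rewrite sp_encodeE /= size_flatten_bits -sp_encodeE /input_size /=.
move: (\sum_(v <- _) _) => N; case: x => n t F uniq_F size_F /= le_N.
have small : (0 < n) || (size F <= 1).
  case: n F uniq_F {size_F le_N} => // F /card_uniqP <-.
  by apply: leq_trans (max_card _) _; rewrite -cardsT -powersetT card_powerset cardsT card_ord.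
have le_f : size F <= (size F * n).+1.
  by case: n {F uniq_F size_F} (size F) small le_N => [|n] f /=; rewrite ?mulnS; lia.
rewrite /capN; case: (size F) small le_N le_f => [|f] /= small le_N le_f.
  by split; lia.
have : n <= f.+1 * n by rewrite leq_pmull.
by split=> //; lia.
Qed.

Lemma reduction_cost : exists K : nat, forall k (x : set_partitioning_instance k),
  let N1 := (input_size (Pi := set_partitioning k) x).+1 in
  let y := reduce x in
  [/\ exists2 t, t <= K * N1 ^ 2 & forall w,
        exec reduction (init (sp_encode x)) w (init (ss_encode y)) w t,
      (input_size (Pi := subset_sum) y).+1 <= K * N1 ^ 2
    & 2 ^ bitlen (ss_target y) <= K * N1 ^ 4 * 2 ^ sp_n x].
Proof.
(* 600 is 3 times the factor 200 of [runs_reduction], as [n], [f] and [f * n] are each at most [N];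
   the detour keeps [K] opaque. *)
have [K K_def] : exists K, K = 600 by exists 600.
(* The first summand bounds the time and the output size; 162 is [2 * 3 ^ 4], from [target_bitlen]
   with [n.+3 <= 3 * N1]. *)
exists (3 * K * K.+1 + 162) => k x N1 y.
have := sp_size_bounds x => /= -[n_or_f nN fN fnN].
set f := size (sp_family x) in n_or_f nN fN fnN.
set n := capN (sp_n x) f in n_or_f nN fN fnN.
have := @runs_reduction (sp_n x) (sp_target x) f (flatten [seq bits A | A <- sp_family x]).
rewrite -/n size_flatten_bits -[_ * sp_n x]mul_capN -/f -/n => /(_ n_or_f (leqnn _)).
move=> H; have {}H : runs reduction (init (sp_encode x)) (init (ss_encode y)) (K * N1).
  have -> : ss_encode y = [:: f, target n (capT n (sp_target x)) &
      row_items n f (flatten [seq bits A | A <- sp_family x])].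
    by rewrite /ss_encode /= size_mkseq.
  apply: runs_weaken H; rewrite K_def; move: (f * n) fnN => q; rewrite /N1; lia.
have L0 : 0 < N1.-1.
  by apply: leq_trans (size_le_input_size (sp_encode x)); rewrite sp_encodeE.
have bounded_init : bounded N1.-1 (init (sp_encode x)).
  split=> [a|a] /=; first by rewrite expn_gt0.
  have [lt_a|le_a] := ltnP a (size (sp_encode x)); last by rewrite nth_default // expn_gt0.
  by rewrite -bitlen_leE // bitlen_le_input_size // mem_nth.
have [t [ht le_t [_ out_le]]] := H _ L0 bounded_init.
have K0 : 0 < K by rewrite K_def.
have LK : N1.-1 + K * N1 < K.+1 * N1 by rewrite mulSn ltn_add2r.
split.
- exists t => //; apply: leq_trans le_t _.
  apply: leq_trans (leq_mul (leqnn _) (ltnW LK)) _.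
  rewrite mulnDl; apply: leq_trans (leq_addr _ _).
  by rewrite -mulnn !mulnA [3 * K * N1 * _]mulnAC.
- have size_y : size (ss_encode y) <= N1.+1.
    by rewrite /= size_mkseq !ltnS; apply: fN.
  have le_y v : v \in ss_encode y -> bitlen v <= N1.-1 + K * N1.
    move=> /(nthP 0)[a _ <-]; rewrite bitlen_leE; last by rewrite addn_gt0 L0.
    exact: out_le.
  have : input_size (Pi := subset_sum) y <= size (ss_encode y) * (N1.-1 + K * N1).
    rewrite /input_size -[size _]sum1_size big_distrl big_seq [leqRHS]big_seq.
    by apply: leq_sum => v /le_y; rewrite /= mul1n.
  move=> le_size.
  apply: (@leq_trans (N1.+1 * (K.+1 * N1))).
    apply: leq_ltn_trans le_size _.
    apply: (@leq_ltn_trans (N1.+1 * (N1.-1 + K * N1))); first by rewrite leq_mul2r size_y orbT.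
    by rewrite ltn_mul2l LK.
  apply: (@leq_trans (2 * N1 * (K.+1 * N1))); first by rewrite leq_mul // mul2n -addnn; lia.
  rewrite mulnACA mulnn leq_mul2r; apply/orP; right.
  apply: leq_trans (leq_addr _ _); rewrite leq_mul2r /=; lia.
- apply: leq_trans (target_bitlen (capT_le _ _)) _.
  rewrite leq_mul ?leq_exp2l ?capN_le //.
  apply: (@leq_trans (2 * (3 * N1) ^ 4)).
    by rewrite leq_mul2l /= leq_exp2r // -/f -/n /N1; lia.
  by rewrite expnMn mulnA leq_mul // leq_addl.
Qed.

(** * Exponents *)

From mathcomp Require Import all_classical all_reals all_analysis.
Import Order.TTheory GRing.Theory Num.Theory.
Import numFieldNormedType.Exports.
Local Open Scope classical_set_scope.
Local Open Scope ring_scope.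
Local Open Scope ereal_scope.

(** Raising the bound on [2 ^ m] to the power [eps] leaves a factor [K * N1 ^ 4] to the power [eps],
    which a natural [E >= eps] makes polynomial. The time [t] is absorbed because [2 ^ (eps * n)] is
    at least 1. *)
Lemma reduction_time_le (R : realType) (eps : R) (E K a d m n N1 t S : nat) :
  (0 <= eps)%R -> (eps <= E%:R)%R -> (0 < N1)%N ->
  (t <= K * N1 ^ 2)%N -> (S <= K * N1 ^ 2)%N -> (2 ^ m <= K * N1 ^ 4 * 2 ^ n)%N ->
  (t%:R + 2 `^ (eps * m%:R) * (a * S ^ d)%:R <=
   2 `^ (eps * n%:R) * ((K + K ^ E * a * K ^ d) * N1 ^ (2 + 4 * E + 2 * d))%:R :> R)%R.
Proof.
move=> eps0 epsE N0 le_t le_S le_m.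
have pow2 k : (2 `^ (eps * k%:R) = ((2 ^ k)%N%:R : R) `^ eps :> R)%R.
  by rewrite mulrC powRrM powR_mulrn // natrX.
have KN0 : (0 < K * N1 ^ 4)%N.
  by rewrite lt0n; apply: contraTneq le_m => ->; rewrite mul0n -ltnNge expn_gt0.
have le_pow : (2 `^ (eps * m%:R) <= 2 `^ (eps * n%:R) * ((K * N1 ^ 4) ^ E)%N%:R :> R)%R.
  rewrite !pow2; apply: (@le_trans _ _ (((K * N1 ^ 4 * 2 ^ n)%N%:R : R) `^ eps)%R).
    by apply: ge0_ler_powR; rewrite ?nnegrE ?ler0n ?ler_nat.
  move: KN0; move: (K * N1 ^ 4)%N => M M0.
  rewrite natrM powRM // mulrC ler_wpM2l ?powR_ge0 // natrX -[leRHS]powR_mulrn //.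
  by apply: ler_powR => //; rewrite ler1n.
have le_1 : (1 <= 2 `^ (eps * n%:R) :> R)%R.
  by rewrite -[leLHS](powRr0 2); apply: ler_powR; rewrite ?ler1n // mulr_ge0.
apply: (@le_trans _ _ (2 `^ (eps * n%:R) *
    (K * N1 ^ 2 + (K * N1 ^ 4) ^ E * (a * (K * N1 ^ 2) ^ d))%N%:R)%R).
  rewrite natrD mulrDr lerD //.
    by rewrite -[leLHS]mul1r; apply: ler_pM; rewrite ?ler_nat.
  rewrite [X in (_ <= _ * X)%R]natrM mulrA; apply: ler_pM; rewrite ?powR_ge0 //.
  rewrite ler_nat leq_mul //.
  by case: d => // d; rewrite leq_exp2r.
rewrite ler_wpM2l ?powR_ge0 // ler_nat mulnDl leq_add //.
  by rewrite leq_mul2l leq_pexp2l ?orbT // -addnA leq_addr.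
rewrite (expnMn K (N1 ^ 4)) (expnMn K (N1 ^ 2)) -!expnM.
have -> : (N1 ^ (2 + 4 * E + 2 * d) = N1 ^ 2 * (N1 ^ (4 * E) * N1 ^ (2 * d)))%N.
  by rewrite -!expnD addnA.
move: (K ^ E)%N (K ^ d)%N (N1 ^ (4 * E))%N (N1 ^ (2 * d))%N => u v y z.
apply: (@leq_trans (u * a * v * (y * z)))%N; last by rewrite leq_mul2l leq_pmull ?orbT // expn_gt0 N0.
by rewrite [(a * (v * z))%N]mulnA mulnACA [(u * (a * v))%N]mulnA.
Qed.

(** The reduction consumes no random bits, so the composed program has the same outcome function and
    the same error probability. *)
Lemma set_partitioning_solvable (R : realType) (k : nat) (eps : R) : (0 < eps)%R ->
  solvable_with_exponent (Pi := subset_sum) target_bits eps ->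
  solvable_with_exponent (Pi := set_partitioning k) (@universe_size k) eps.
Proof.
move=> eps0 [c [a [d solve]]]; have [K cost] := reduction_cost.
have epsE : (eps <= (Num.bound eps)%:R)%R by rewrite ltW // archi_boundP // ltW.
move: (Num.bound eps) epsE => E epsE.
exists (Seq reduction c), (K + K ^ E * a * K ^ d)%N, (2 + 4 * E + 2 * d)%N => x.
have [[t1 le_t1 run1] le_size le_bits] := cost k x.
have [l [out [run2 err]]] := solve (reduce x).
exists l, out; split; last by move: err; rewrite /= ss_answer_reduce.
move=> w; have [s [w' [t2 [ex acc le_t2]]]] := run2 w.
exists s, w', (t1 + t2)%N; split=> //; first exact: exec_seq (run1 _) ex.
apply: le_trans (reduction_time_le a d (ltW eps0) epsE _ le_t1 le_size le_bits) => //.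
by rewrite natrD lerD2l.
Qed.

Lemma sigma_le (R : realType) (P Q : problem) (p : instance P -> nat) (q : instance Q -> nat) :
  (forall eps : R, (0 < eps)%R ->
    solvable_with_exponent q eps -> solvable_with_exponent p eps) ->
  sigma R P p <= sigma R Q q.
Proof.
move=> PQ; apply: le_ereal_inf => _ [eps [eps0 solve] <-].
by exists eps => //; split=> //; apply: PQ.
Qed.

(** An instance for [k] is also one for [k'], with the same encoding and answer, so the same program
    serves. *)
Lemma set_partitioning_mono (R : realType) (k k' : nat) (eps : R) : (k <= k')%N ->
  solvable_with_exponent (Pi := set_partitioning k') (@universe_size k') eps ->
  solvable_with_exponent (Pi := set_partitioning k) (@universe_size k) eps.
Proof.
move=> kk' [c [a [d solve]]]; exists c, a, d => -[n t F uniq_F size_F].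
have size_F' : all (fun A : {set 'I_n} => #|A| <= k')%N F.
  by apply: sub_all size_F => A /leq_trans; apply.
exact: (solve (SetPartitioningInstance t uniq_F size_F')).
Qed.

Theorem theorem23 (R : realType) :
  cvgn (fun k : nat => sigma R (set_partitioning k) (@universe_size k)) /\
  limn (fun k : nat => sigma R (set_partitioning k) (@universe_size k)) <= sigma R subset_sum target_bits.
Proof.
have cvg_sigma : cvgn (fun k : nat => sigma R (set_partitioning k) (@universe_size k)).
  (* Monotone sequences converge in the extended reals, also when the exponents are infinite. *)
  apply: ereal_nondecreasing_is_cvgn => k k' kk'.
  by apply: sigma_le => eps _; apply: set_partitioning_mono.
split=> //; apply: lime_le => //; apply: nearW => k.
by apply: sigma_le => eps; apply: set_partitioning_solvable.
Qed.
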